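(* Let $n\ge 1$, $\alpha\in(0,1)$, let $p=(p_1,\dots,p_n)$ be a $[0,1]^n$-valued random vector of p-values, and let $\{1,\dots,n\}=I_0\cup I_1$ be a disjoint union with $n_0=|I_0|>0$ and $n_1=|I_1|=n-n_0$. Assume $\mathbb{E}\left[\sum_{i\in I_0}\mathbb{I}(p_i\le t)\right]\le n_0t$ for all $t\in[0,1)$. Let $\beta_i=\frac{i\alpha}{n+1-i(1-\alpha)}$, $1\le i\le n$, let $T=\{0,\beta_1,\dots,\beta_n\}$, and let $\mathcal{F}_t^T=\sigma\{\mathbb{I}(p_i\le s): s\le t,\ s\in T,\ i\le n\}$, $t\in T$. Suppose that the process $$M_{I_0}(t)=\sum_{i\in I_0}\frac{\mathbb{I}(p_i\le t)-t}{1-t},\qquad t\in T,$$ is a super-martingale with respect to $(\mathcal{F}_t^T)_{t\in T}$. Then for the step down procedure with critical values $\beta_i$, $i\le n$, with critical boundary value $\tau_{SD}$, $$\mathbb{E}\left[V(\tau_{SD})\right]\le \frac{\alpha}{1-\alpha}\left(\mathbb{E}\left[S(\tau_{SD})\right]+1\right)\le \frac{\alpha}{1-\alpha}(n_1+1).$$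
   Context: $I_0$ is the (unknown) index set of true null hypotheses and $I_1$ that of false ones. $p_{1:n}\le\dots\le p_{n:n}$ denote the ordered p-values. The step down (SD) critical boundary value is $\tau_{SD}=\max\{\beta_i: p_{j:n}\le\beta_j \text{ for all } j\le i\}$ with $\max\emptyset=0$; hypotheses with $p_i\le\tau_{SD}$ are rejected. $V(\tau)=\sum_{i\in I_0}\mathbb{I}(p_i\le\tau)$ is the number of false rejections and $S(\tau)=\sum_{i\in I_1}\mathbb{I}(p_i\le\tau)$ the number of true rejections. $\mathbb{I}(\cdot)$ is the indicator function. *)

(* Defs.v *)
From mathcomp Require Export all_boot all_order all_algebra.
From mathcomp Require Export all_classical all_reals all_analysis.

Set Implicit Arguments.
Unset Strict Implicit.
Unset Printing Implicit Defensive.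

Import Order.TTheory GRing.Theory Num.Theory.
Local Open Scope classical_set_scope.
Local Open Scope ring_scope.

Section conditional_expectation.
Context {d : measure_display} {Omega : measurableType d} {R : realType}.
Variable P : probability Omega R.

Definition measurable_wrt (G : set (set Omega)) (X : Omega -> R) : Prop :=
  forall B : set R, measurable B -> G (X @^-1` B).

(* [Y] is a version of the conditional expectation of [X] given the
   sub-sigma-algebra [G]. *)
Definition is_cond_expectation (G : set (set Omega)) (X Y : Omega -> R) : Prop :=
  [/\ measurable_wrt G Y,
      P.-integrable setT (EFin \o Y) &
      forall A : set Omega, G A ->
        (\int[P]_(w in A) (Y w)%:E = \int[P]_(w in A) (X w)%:E)%E].

(* [M] is a super-martingale over the set of times [D] with respect to the
   filtration [F].  Versions of a conditional expectation agree almost surely,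
   so bounding one of them is the same as bounding all of them. *)
Definition supermartingale (D : set R) (F : R -> set (set Omega))
    (M : R -> Omega -> R) : Prop :=
  [/\ forall t, D t -> measurable_wrt (F t) (M t),
      forall t, D t -> P.-integrable setT (EFin \o M t) &
      forall s t, D s -> D t -> s <= t ->
        exists2 Y : Omega -> R, is_cond_expectation (F s) (M t) Y &
          {ae P, forall w, Y w <= M s w}].

End conditional_expectation.

Section step_down.
Context {Omega : Type} {R : realType} {n : nat}.
Implicit Types (I : {set 'I_n}) (p : 'I_n -> Omega -> R) (beta : nat -> R).

(* Critical values and order statistics are indexed from 1 to [n]. *)
Definition critical_value (alpha : R) (i : nat) : R :=
  i%:R * alpha / (n.+1%:R - i%:R * (1 - alpha)).

Definition order_stat p (j : nat) (w : Omega) : R :=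
  nth 0 (sort <=%R [seq p i w | i <- enum 'I_n]) j.-1.

(* The default value 0 does not affect a nonempty maximum, as long as the
   critical values are nonnegative. *)
Definition tau_SD beta p (w : Omega) : R :=
  \big[Num.max/0]_(1 <= i < n.+1 |
      all (fun j => order_stat p j w <= beta j) (iota 1 i)) beta i.

(* For [I] the set of true (resp. false) null hypotheses, this is the number
   of false (resp. true) rejections at threshold [t]. *)
Definition nb_rejections I p (t : R) (w : Omega) : R :=
  \sum_(i in I) (p i w <= t)%R%:R.

Definition times beta : set R :=
  [set t | t = 0 \/ exists2 i : nat, (1 <= i <= n)%N & t = beta i].

Definition indicator_filtration (D : set R) p (t : R) : set (set Omega) :=
  <<s [set A | exists (i : 'I_n) (s : R) (B : set R),
         [/\ D s, s <= t, measurable B &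
             A = (fun w => (p i w <= s)%R%:R : R) @^-1` B]] >>.

Definition M_process I p (t : R) (w : Omega) : R :=
  \sum_(i in I) ((p i w <= t)%R%:R - t) / (1 - t).

End step_down.

Arguments critical_value {R} n alpha i.
Arguments times {R} n beta.

(* Main.v *)
Require Import Defs.
From mathcomp Require Import measurable_realfun ring lra zify.
Set Implicit Arguments.
Unset Strict Implicit.
Unset Printing Implicit Defensive.

Import Order.TTheory GRing.Theory Num.Theory.
Local Open Scope classical_set_scope.
Local Open Scope ring_scope.

(** Let [K] be the largest index such that the [j]-th smallest p-value is at
    most [beta j] for all [j <= K], so that [tau_SD = beta K] ([tau_SDE]).  When
    [K < n], exactly [K] p-values are at most [beta K], and none of the others is
    at most [beta K.+1].

    The threshold [beta K] is in general not a stopping time, because the failure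
    of the comparison with [beta K.+1] has to be observed.  The next one,
    [beta (minn K.+1 n)], is a stopping time: the event [j < minn K.+1 n] is,
    for [j < n], the event [j <= K], which depends only on the counts of p-values
    up to [beta 1], ..., [beta j].  By optional stopping over these finitely many
    times ([optional_stopping]), the mean of the super-martingale at this time is
    at most its mean at time 0, which is nonpositive by the assumption on the
    true null p-values.

    It remains to bound the stopped process below, pointwise, by
    [(1 - alpha) * V - alpha * (S + 1)] ([M_process_stopped_ge]).  If [K < n],
    then the numbers of rejections at [beta K.+1] and [beta K] agree.  Since
    [b / (1 - b) = (K + 1) * alpha / (n - K)] for [b = beta K.+1], the stopped
    process is [V - (n0 - V) * (K + 1) * alpha / (n - K)], which is at least
    [V - alpha * (K + 1)] because [n - K = (n0 - V) + (n1 - S)], and [K = V + S].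
    If [K = n], then everything is rejected and the stopped process is [n0 = V].
    Taking means gives the first inequality; the second one is [S <= n1]. *)

(** * Counting rejections *)

Lemma nb_rejectionsE (Omega : Type) (R : realType) (n : nat) (I : {set 'I_n})
    (p : 'I_n -> Omega -> R) (t : R) (w : Omega) :
  nb_rejections I p t w = #|[set i in I | p i w <= t]%SET|%:R.
Proof.
rewrite /nb_rejections -natr_sum; congr (_%:R).
rewrite -sum1_card big_mkcond [RHS]big_mkcond /=.
by apply: eq_bigr => i _; rewrite inE; case: (i \in I); case: (_ <= _).
Qed.

Lemma nb_rejections_ge0 (Omega : Type) (R : realType) (n : nat)
    (I : {set 'I_n}) (p : 'I_n -> Omega -> R) (t : R) (w : Omega) :
  0 <= nb_rejections I p t w.
Proof. by rewrite nb_rejectionsE ler0n. Qed.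

Lemma nb_rejections_le_card (Omega : Type) (R : realType) (n : nat)
    (I : {set 'I_n}) (p : 'I_n -> Omega -> R) (t : R) (w : Omega) :
  nb_rejections I p t w <= #|I|%:R.
Proof.
rewrite nb_rejectionsE ler_nat subset_leq_card //.
by apply/fintype.subsetP => i; rewrite inE => /andP[].
Qed.

Lemma nb_rejections_setU (Omega : Type) (R : realType) (n : nat)
    (I J : {set 'I_n}) (p : 'I_n -> Omega -> R) (t : R) (w : Omega) :
  (I :&: J)%SET = finset.set0 ->
  nb_rejections (I :|: J)%SET p t w
  = nb_rejections I p t w + nb_rejections J p t w.
Proof.
move=> IJ0; rewrite /nb_rejections -bigU /=.
  by apply: eq_bigl => i; rewrite !inE.
by rewrite -setI_eq0 IJ0.
Qed.

(** Order statistics are handled only through counts of p-values, which are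
    determined by the indicators that generate the filtration. *)
Lemma order_stat_le (Omega : Type) (R : realType) (n : nat)
    (p : 'I_n -> Omega -> R) (j : nat) (t : R) (w : Omega) :
  (0 < j <= n)%N ->
  (order_stat p j w <= t) = (j%:R <= nb_rejections [set: 'I_n]%SET p t w).
Proof.
move=> /andP[j0 jn]; rewrite nb_rejectionsE ler_nat.
set s := [seq p i w | i <- enum 'I_n].
have -> : #|[set i in [set: 'I_n] | p i w <= t]%SET|
        = count (<= t)%O (sort <=%R s).
  rewrite (permP (permEl (perm_sort _ _))) /s count_map.
  rewrite cardE -size_filter; congr size.
  by rewrite enumT; apply: eq_filter => i; rewrite !inE.
have ss : sorted <=%O (sort <=%R s) by exact: sort_le_sorted.
have sz : size (sort <=%R s) = n by rewrite size_sort size_map size_enum_ord.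
rewrite /order_stat -/s; apply/idP/idP => [|h].
  apply: contraTT; rewrite -ltnNge -ltNge => h.
  by apply: nth_count_gt => //; rewrite sz -ltnS prednK // h.
by apply: nth_count_le => //; rewrite prednK.
Qed.

(** * The index of the step down procedure *)

(** The number of consecutive order statistics, starting from the smallest, that
    are at most their critical value.  The positions found by [find] start at 0
    while the order statistics start at 1, so the position of the first failure
    is the index of the last success; it is [n] when there is no failure. *)
Definition sd_index (Omega : Type) (R : realType) (n : nat) (beta : nat -> R)
    (p : 'I_n -> Omega -> R) (w : Omega) : nat :=
  find (fun j => ~~ (order_stat p j w <= beta j)) (iota 1 n).

Lemma sd_index_le (Omega : Type) (R : realType) (n : nat) (beta : nat -> R)
    (p : 'I_n -> Omega -> R) (w : Omega) :
  (sd_index beta p w <= n)%N.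
Proof. by rewrite /sd_index -[leqRHS](size_iota 1) find_size. Qed.

Lemma sd_indexP (Omega : Type) (R : realType) (n : nat) (beta : nat -> R)
    (p : 'I_n -> Omega -> R) (w : Omega) (i : nat) : (i <= n)%N ->
  all (fun j => order_stat p j w <= beta j) (iota 1 i)
  = (i <= sd_index beta p w)%N.
Proof.
move=> hin; apply/allP/idP => [h|h j].
  rewrite leqNgt; apply/negP => lt_i.
  have hlt := leq_trans lt_i hin.
  have hasf : has (fun j => ~~ (order_stat p j w <= beta j)) (iota 1 n).
    by rewrite has_find size_iota.
  have := nth_find 0%N hasf; rewrite -/(sd_index beta p w) nth_iota // => /negP.
  by apply; apply: h; rewrite mem_iota; lia.
rewrite mem_iota => /andP[j1 ji].
have /(before_find 0%N) : (j.-1 < sd_index beta p w)%N by lia.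
by rewrite nth_iota; [rewrite add1n prednK // => /negbFE | lia].
Qed.

Lemma tau_SDE (Omega : Type) (R : realType) (n : nat) (beta : nat -> R)
    (p : 'I_n -> Omega -> R) (w : Omega) :
  beta 0%N = 0 ->
  (forall i j, (i <= j <= n)%N -> beta i <= beta j) ->
  tau_SD beta p w = beta (sd_index beta p w).
Proof.
move=> beta0 beta_homo; have Kn := sd_index_le beta p w.
apply/le_anti/andP; split.
  rewrite /tau_SD big_seq_cond; apply: bigmax_le.
    by rewrite -beta0 beta_homo.
  move=> i /andP[]; rewrite mem_index_iota => hi; rewrite sd_indexP; last lia.
  by move=> iK; apply: beta_homo; lia.
rewrite /tau_SD; have [->|K0] := posnP (sd_index beta p w).
  by rewrite beta0 bigmax_ge_id.
apply: (le_bigmax_seq 0 (sd_index beta p w)).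
  by rewrite mem_index_iota K0 ltnS.
by rewrite sd_indexP.
Qed.

Lemma sd_index_le_nb_rejections (Omega : Type) (R : realType) (n : nat)
    (beta : nat -> R) (p : 'I_n -> Omega -> R) (w : Omega) :
  (sd_index beta p w)%:R
    <= nb_rejections [set: 'I_n]%SET p (beta (sd_index beta p w)) w.
Proof.
have Kn := sd_index_le beta p w.
have [->|K0] := posnP (sd_index beta p w); first exact: nb_rejections_ge0.
rewrite -order_stat_le ?K0 //.
have := sd_indexP beta p w Kn; rewrite leqnn => /allP; apply.
by rewrite mem_iota; lia.
Qed.

Lemma nb_rejections_lt_sd_index (Omega : Type) (R : realType) (n : nat)
    (beta : nat -> R) (p : 'I_n -> Omega -> R) (w : Omega) :
  (sd_index beta p w < n)%N ->
  nb_rejections [set: 'I_n]%SET p (beta (sd_index beta p w).+1) w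
    < (sd_index beta p w).+1%:R.
Proof.
move=> Kn; rewrite ltNge -order_stat_le //.
apply/negP => h; have := sd_indexP beta p w Kn.
rewrite ltnn -[X in iota _ X]addn1 iotaD all_cat add1n /= h !andbT.
by rewrite sd_indexP ?leqnn // ltnW.
Qed.

(** No p-value is both greater than [beta K] and at most [beta K.+1]: at least
    [K] p-values are at most [beta K], and at most [K] are at most
    [beta K.+1]. *)
Lemma nb_rejections_sd_succ (Omega : Type) (R : realType) (n : nat)
    (beta : nat -> R) (p : 'I_n -> Omega -> R) (I : {set 'I_n}) (w : Omega)
    (K := sd_index beta p w) :
  (K < n)%N -> beta K <= beta K.+1 ->
  nb_rejections I p (beta K.+1) w = nb_rejections I p (beta K) w.
Proof.
move=> Kn leb; have := nb_rejections_lt_sd_index Kn.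
have := sd_index_le_nb_rejections beta p w.
rewrite -/K !nb_rejectionsE ler_nat ltr_nat => hA hB.
set A := [set i in [set: 'I_n] | p i w <= beta K]%SET in hA.
set B := [set i in [set: 'I_n] | p i w <= beta K.+1]%SET in hB.
have /eqP AB : A == B.
  rewrite eqEcard (@leq_trans K) ?andbT //; apply/fintype.subsetP => i.
  by rewrite !inE /= => /le_trans; apply.
congr (#|pred_of_set _|%:R); apply/setP => i.
by move/setP : AB => /(_ i); rewrite !inE /= => ->.
Qed.

Lemma nb_rejections_sd_index (Omega : Type) (R : realType) (n : nat)
    (beta : nat -> R) (p : 'I_n -> Omega -> R) (w : Omega)
    (K := sd_index beta p w) :
  ((K < n)%N -> beta K <= beta K.+1) ->
  nb_rejections [set: 'I_n]%SET p (beta K) w = K%:R.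
Proof.
move=> leb; apply/le_anti/andP; split; last first.
  exact: sd_index_le_nb_rejections.
have := sd_index_le beta p w; rewrite -/K leq_eqVlt => /orP[/eqP ->|Kn].
  by rewrite (le_trans (nb_rejections_le_card _ _ _ _)) // cardsT card_ord.
rewrite -nb_rejections_sd_succ ?leb // -/K.
have := nb_rejections_lt_sd_index Kn.
by rewrite -/K !nb_rejectionsE ltr_nat ler_nat ltnS.
Qed.

(** * The critical values *)

Lemma critical_value0 (R : realType) (n : nat) (alpha : R) :
  critical_value n alpha 0 = 0.
Proof. by rewrite /critical_value !mul0r. Qed.

Lemma critical_value_den_gt0 (R : realType) (n i : nat) (alpha : R) :
  0 < alpha < 1 -> (i <= n)%N -> 0 < n.+1%:R - i%:R * (1 - alpha) :> R.
Proof.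
move=> /andP[a0 a1] hin; have : i%:R <= n%:R :> R by rewrite ler_nat.
have : 0 <= i%:R :> R by [].
rewrite -[n.+1]addn1 natrD; nra.
Qed.

Lemma subr1_critical_value (R : realType) (n i : nat) (alpha : R) :
  0 < alpha < 1 -> (i <= n)%N ->
  1 - critical_value n alpha i
  = (n.+1%:R - i%:R) / (n.+1%:R - i%:R * (1 - alpha)).
Proof.
move=> a01 hin; have /lt0r_neq0 D0 := critical_value_den_gt0 a01 hin.
rewrite /critical_value -[X in X - _](divff D0) -mulrBl; congr (_ / _).
by ring.
Qed.

Lemma critical_value_lt1 (R : realType) (n i : nat) (alpha : R) :
  0 < alpha < 1 -> (i <= n)%N -> critical_value n alpha i < 1.
Proof.
move=> a01 hin; rewrite -subr_gt0 subr1_critical_value //.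
by rewrite divr_gt0 ?critical_value_den_gt0 // subr_gt0 ltr_nat ltnS.
Qed.

Lemma critical_value_homo (R : realType) (n i j : nat) (alpha : R) :
  0 < alpha < 1 -> (i <= j <= n)%N ->
  critical_value n alpha i <= critical_value n alpha j.
Proof.
move=> a01 /andP[ij jn]; have hin := leq_trans ij jn.
have Di := critical_value_den_gt0 a01 hin.
have Dj := critical_value_den_gt0 a01 jn.
rewrite /critical_value ler_pdivrMr // mulrAC ler_pdivlMr //.
have leij : i%:R <= j%:R :> R by rewrite ler_nat.
have n0 : 0 <= n.+1%:R :> R by [].
have /andP[a0 a1] := a01.
rewrite -subr_ge0.
have -> : j%:R * alpha * (n.+1%:R - i%:R * (1 - alpha))
          - i%:R * alpha * (n.+1%:R - j%:R * (1 - alpha))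
          = alpha * n.+1%:R * (j%:R - i%:R) by ring.
by rewrite mulr_ge0 ?subr_ge0 // mulr_ge0 // ltW.
Qed.

(** * The process at the stopping time *)

Lemma M_processE (Omega : Type) (R : realType) (n : nat) (I : {set 'I_n})
    (p : 'I_n -> Omega -> R) (t : R) (w : Omega) :
  M_process I p t w = (nb_rejections I p t w - #|I|%:R * t) / (1 - t).
Proof.
by rewrite /M_process -mulr_suml big_split /= sumr_const mulNrn mulr_natl.
Qed.

Lemma M_process_stopped_ge (Omega : Type) (R : realType) (n : nat) (alpha : R)
    (p : 'I_n -> Omega -> R) (I0 I1 : {set 'I_n}) (w : Omega)
    (beta := critical_value n alpha) (K := sd_index beta p w) :
  0 < alpha < 1 ->
  (I0 :|: I1)%SET = [set: 'I_n]%SET -> (I0 :&: I1)%SET = finset.set0 ->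
  (1 - alpha) * nb_rejections I0 p (beta K) w
    - alpha * (nb_rejections I1 p (beta K) w + 1)
  <= M_process I0 p (beta (minn K.+1 n)) w.
Proof.
move=> a01 cover disj; have /andP[a0 a1] := a01.
have leb : (K < n)%N -> beta K <= beta K.+1.
  by move=> Kn; apply: critical_value_homo => //; rewrite leqnSn.
have : nb_rejections [set: 'I_n]%SET p (beta K) w = K%:R.
  exact: nb_rejections_sd_index.
rewrite -cover nb_rejections_setU //.
have v0 := nb_rejections_le_card I0 p (beta K) w.
have s1 := nb_rejections_le_card I1 p (beta K) w.
have s0 := nb_rejections_ge0 I1 p (beta K) w.
have n01 : #|I0|%:R + #|I1|%:R = n%:R :> R.
  by rewrite -natrD -cardsUI cover disj cards0 addn0 cardsT card_ord.
have vge0 := nb_rejections_ge0 I0 p (beta K) w.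
have := sd_index_le beta p w; rewrite -/K leq_eqVlt => /orP[/eqP Kn|Kn] vs.
  rewrite Kn in v0 s0 s1 vs vge0 *; rewrite (minn_idPr (leqnSn n)) M_processE.
  (* Everything is rejected, so the stopped process is [#|I0|]. *)
  have -> : nb_rejections I0 p (beta n) w = #|I0|%:R by lra.
  have b1 : 1 - beta n != 0 by rewrite subr_eq0 gt_eqF // critical_value_lt1.
  rewrite [leRHS](_ : _ = #|I0|%:R); last by field.
  nra.
rewrite (minn_idPl Kn) M_processE nb_rejections_sd_succ ?leb // -/K.
have D0 := critical_value_den_gt0 a01 Kn.
rewrite ler_pdivlMr ?subr_gt0 ?critical_value_lt1 //.
rewrite subr1_critical_value // mulrA ler_pdivrMr //.
rewrite [leRHS]mulrBl -[X in _ <= _ - X]mulrA divfK ?lt0r_neq0 //.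
move: v0 s1 s0 vge0 vs n01.
set v := nb_rejections I0 _ _ _; set s := nb_rejections I1 _ _ _.
rewrite -!natr1 => v0 s1 s0 vge0 vs n01.
(* After clearing denominators, the two sides differ by this product. *)
have Ka0 : 0 <= alpha * (K%:R + 1) * (#|I1|%:R - s).
  by rewrite mulr_ge0 ?subr_ge0 // mulr_ge0 ?addr_ge0 // ltW.
rewrite -subr_ge0 -n01 -vs; rewrite -vs in Ka0.
by rewrite (_ : _ - _ = alpha * (v + s + 1) * (#|I1|%:R - s)) //; ring.
Qed.

(** * Measurability *)

(** Only the indicators are assumed measurable, not the p-values, so that this
    applies to the sigma-algebras of the filtration. *)
Lemma measurable_nb_rejections (d : measure_display) (T : measurableType d)
    (R : realType) (n : nat) (I : {set 'I_n}) (p : 'I_n -> T -> R) (t : R) :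
  (forall i, measurable_fun setT (fun w => p i w <= t)) ->
  measurable_fun setT (nb_rejections I p t).
Proof.
move=> mp; rewrite /nb_rejections.
under eq_fun do rewrite big_mkcond /=.
apply: measurable_sum => i; case: (i \in I) => //.
rewrite (_ : (fun w => _) = fun w => if p i w <= t then 1 else 0 :> R).
  exact: measurable_fun_ifT.
by apply/funext => w; case: (_ <= _).
Qed.

(** The event [j <= K] involves only the critical values up to the [j]-th. *)
Lemma measurable_sd_index_ge (d : measure_display) (T : measurableType d)
    (R : realType) (n : nat) (beta : nat -> R) (p : 'I_n -> T -> R) (j : nat) :
  (j <= n)%N ->
  (forall i k, (0 < k <= j)%N ->
    measurable_fun setT (fun w => p i w <= beta k)) ->
  measurable_fun setT (fun w => (j <= sd_index beta p w)%N).
Proof.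
move=> jn mp; under eq_fun do rewrite -sd_indexP //.
elim: j jn mp => [|j IH] jn mp; first exact: measurable_cst.
under eq_fun do rewrite -[X in iota _ X]addn1 iotaD all_cat add1n /= andbT.
apply: measurable_and.
  apply: IH => [|i k /andP[k0 kj]]; first exact: ltnW.
  by apply: mp; rewrite k0 leqW.
under eq_fun do rewrite order_stat_le //.
apply: measurable_fun_ler; first exact: measurable_cst.
by apply: measurable_nb_rejections => i; apply: mp; rewrite leqnn.
Qed.

(** A process observed at a bounded random index. *)
Lemma measurable_sampled (d d' : measure_display) (T : measurableType d)
    (U : measurableType d') (f : nat -> T -> U) (N : nat) (K : T -> nat) :
  (forall w, (K w <= N)%N) ->
  (forall j, (j <= N)%N -> measurable_fun setT (f j)) ->
  (forall j, (j < N)%N -> measurable_fun setT (fun w => (j < K w)%N)) ->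
  measurable_fun setT (fun w => f (K w) w).
Proof.
move=> KN mf mK.
(* Induction on the cap [m], up to the bound [N]. *)
suff H m : (m <= N)%N -> measurable_fun setT (fun w => f (minn (K w) m) w).
  by have := H N (leqnn N); under eq_fun do rewrite (minn_idPl (KN _)).
elim: m => [|m IH] mN.
  by under eq_fun do rewrite minn0; exact: mf.
have E w : f (minn (K w) m.+1) w
    = if (m < K w)%N then f m.+1 w else f (minn (K w) m) w.
  case: ltnP => h; first by rewrite (minn_idPr h).
  by rewrite (minn_idPl (leqW h)).
under eq_fun do rewrite E.
by apply: measurable_fun_ifT; [exact: mK|exact: mf|apply: IH; exact: ltnW].
Qed.

(** * Optional stopping *)

Lemma supermartingale_integral_le (d : measure_display)
    (Omega : measurableType d) (R : realType) (P : probability Omega R)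
    (D : set R) (F : R -> set (set Omega)) (M : R -> Omega -> R) (s t : R)
    (A : set Omega) :
  supermartingale P D F M -> D s -> D t -> s <= t ->
  measurable A -> F s A ->
  (\int[P]_(w in A) (M t w)%:E <= \int[P]_(w in A) (M s w)%:E)%E.
Proof.
move=> [_ iM sM] Ds Dt st mA FA.
have [Y [_ iY EY] YM] := sM s t Ds Dt st.
rewrite -EY //.
have iYA : P.-integrable A (EFin \o Y) by apply: integrableS iY.
have iMA : P.-integrable A (EFin \o M s) by apply: integrableS (iM s Ds).
have fY : (\int[P]_(w in A) (Y w)%:E)%E \is a fin_num.
  exact: integrable_fin_num iYA.
rewrite -sube_ge0 ?fY //.
rewrite -integralB_EFin //.
have mY := measurable_int _ iYA; have mM := measurable_int _ iMA.
(* The positive part makes the difference nonnegative everywhere. *)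
rewrite (ae_eq_integral (fun w => maxe ((M s w)%:E - (Y w)%:E) 0)%E) //.
- by apply: integral_ge0 => w _; rewrite le_max lexx orbT.
- exact: emeasurable_funB.
- by apply: measurable_maxe => //; exact: emeasurable_funB.
- move: YM; apply: filterS => w YM _; rewrite /= max_l //.
  by rewrite lee_fin subr_ge0.
Qed.

(** Optional stopping for a random index [J] bounded by [N], along the finitely
    many times [u 0 <= ... <= u N].  The stopping condition is that the event
    [j < J], that is, not having stopped at [u j], is known at time [u j]. *)
Lemma optional_stopping (d : measure_display) (Omega : measurableType d)
    (R : realType) (P : probability Omega R) (D : set R)
    (F : R -> set (set Omega)) (M : R -> Omega -> R) (u : nat -> R) (N : nat)
    (J : Omega -> nat) :
  supermartingale P D F M ->
  (forall t, D t -> F t `<=` measurable) ->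
  (forall j, (j <= N)%N -> D (u j)) ->
  (forall j, (j < N)%N -> u j <= u j.+1) ->
  (forall w, (J w <= N)%N) ->
  (forall j, (j < N)%N -> F (u j) [set w | (j < J w)%N]) ->
  P.-integrable setT (EFin \o (fun w => M (u (J w)) w)) /\
  (\int[P]_w (M (u (J w)) w)%:E <= \int[P]_w (M (u 0%N) w)%:E)%E.
Proof.
move=> sM FD Du ule JN FJ; have [_ iM _] := sM.
(* Passing from [X m] to [X m.+1] adds the increment of [M] on [m < J]. *)
pose X m w := M (u (minn (J w) m)) w.
suff H m : (m <= N)%N -> P.-integrable setT (EFin \o X m) /\
    (\int[P]_w (X m w)%:E <= \int[P]_w (M (u 0%N) w)%:E)%E.
  have := H N (leqnn N).
  by rewrite (_ : X N = fun w => M (u (J w)) w) //; apply/funext => w;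
    rewrite /X (minn_idPl (JN w)).
elim: m => [|m IH] mN.
  have -> : X 0%N = M (u 0%N) by apply/funext => w; rewrite /X minn0.
  by split=> //; exact/iM/Du.
have [iX leX] := IH (ltnW mN).
pose A := [set w | (m < J w)%N].
have FA : F (u m) A by exact: FJ.
have mA : measurable A by apply: FD FA; apply: Du; exact: ltnW.
have iM0 : P.-integrable setT (EFin \o M (u m)) by apply/iM/Du/ltnW.
have iM1 : P.-integrable setT (EFin \o M (u m.+1)) by apply/iM/Du.
have iM0A : P.-integrable A (EFin \o M (u m)) by apply: integrableS iM0.
have iM1A : P.-integrable A (EFin \o M (u m.+1)) by apply: integrableS iM1.
pose g := (EFin \o (M (u m.+1) \- M (u m))) \_ A.
have ig : P.-integrable setT g.
  apply/(integrable_mkcond _ mA).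
  exact: (integrableB mA iM1A iM0A).
have EX : EFin \o X m.+1 = ((EFin \o X m) \+ g)%E.
  apply/funext => w; rewrite /g /X /= /patch.
  have [/set_mem/= h|/negP h] := boolP (w \in A).
    by rewrite (minn_idPr h) (minn_idPr (ltnW h)) -EFinD addrC subrK.
  have {}h : (J w <= m)%N by rewrite leqNgt; apply/negP => h'; exact/h/mem_set.
  by rewrite (minn_idPl h) (minn_idPl (leqW h)) addr0.
split; first by rewrite EX; exact: integrableD.
have -> : (\int[P]_w (X m.+1 w)%:E = \int[P]_w ((EFin \o X m) \+ g) w)%E.
  by rewrite -EX.
rewrite integralD // -[leRHS]adde0; apply: leeD => //.
rewrite /g -integral_mkcond.
rewrite (integralB_EFin mA iM1A iM0A).
rewrite sube_le0; apply: (supermartingale_integral_le sM) => //.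
- by apply: Du; exact: ltnW.
- exact: Du.
- exact: ule.
Qed.

(** * The filtration of the indicators *)

Lemma indicator_filtration_sub (d : measure_display) (Omega : measurableType d)
    (R : realType) (n : nat) (D : set R) (p : 'I_n -> Omega -> R) (t : R) :
  (forall i, measurable_fun setT (p i)) ->
  indicator_filtration D p t `<=` measurable.
Proof.
move=> mp; apply: smallest_sub; first exact: sigma_algebra_measurable.
move=> _ [i [s [B [_ _ mB ->]]]].
have mps : measurable_fun setT (fun w => p i w <= s).
  by apply: measurable_fun_ler.
have -> : (fun w => (p i w <= s)%R%:R : R)
    = fun w => if p i w <= s then 1 else 0.
  by apply/funext => w; case: (_ <= _).
rewrite -[X in measurable X]setTI.
by apply: (measurable_fun_ifT mps).
Qed.

Lemma indicator_filtration_sd_index (Omega : pointedType)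
    (R : realType) (n : nat) (D : set R) (beta : nat -> R)
    (p : 'I_n -> Omega -> R) (j : nat) :
  (forall k, (0 < k <= n)%N -> D (beta k)) ->
  (forall i k, (i <= k <= n)%N -> beta i <= beta k) ->
  (j <= n)%N ->
  indicator_filtration D p (beta j) [set w | (j <= sd_index beta p w)%N].
Proof.
move=> Dbeta beta_homo jn; rewrite /indicator_filtration.
set G := (X in <<s X >>).
have : measurable_fun setT
    (fun w : g_sigma_algebraType G => (j <= sd_index beta p w)%N).
  apply: measurable_sd_index_ge => // i k /andP[k0 kj].
  apply: (measurable_fun_bool true); rewrite setTI.
  apply: sub_sigma_algebra; exists i, (beta k), [set 1]; split.
  - by apply: Dbeta; rewrite k0 (leq_trans kj).
  - by apply: beta_homo; rewrite kj.
  - exact: measurable_set1.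
  apply/seteqP; split=> w /=; first by move=> ->.
  by case: (_ <= _) => // /eqP; rewrite eq_sym oner_eq0.
by move=> /(_ measurableT [set true] I); rewrite setTI.
Qed.

(** * The bound on the expected number of false rejections *)

Lemma integrable_nb_rejections_sampled (d : measure_display)
    (Omega : measurableType d) (R : realType) (P : probability Omega R)
    (n : nat) (I : {set 'I_n}) (p : 'I_n -> Omega -> R) (beta : nat -> R) :
  (forall i, measurable_fun setT (p i)) ->
  P.-integrable setT
    (EFin \o (fun w => nb_rejections I p (beta (sd_index beta p w)) w)).
Proof.
move=> mp.
have mps i t : measurable_fun setT (fun w => p i w <= t).
  exact: measurable_fun_ler.
apply: measurable_bounded_integrable => //.
- exact: fin_num_fun_lty.
- apply: (measurable_sampled (N := n)
    (f := fun j => nb_rejections I p (beta j))).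
  + by move=> w; exact: sd_index_le.
  + by move=> j _; exact: measurable_nb_rejections.
  + by move=> j jn; exact: measurable_sd_index_ge.
- exists #|I|%:R; split; first exact: num_real.
  move=> x Ix w _ /=; rewrite ger0_norm ?nb_rejections_ge0 //.
  by rewrite (le_trans (nb_rejections_le_card _ _ _ _)) // ltW.
Qed.

Theorem theorem8 (R : realType) (d : measure_display) (Omega : measurableType d)
  (P : probability Omega R) (n : nat) (alpha : R)
  (p : 'I_n -> {RV P >-> R}) (I0 I1 : {set 'I_n})
  (hn : (1 <= n)%N)
  (halpha : 0 < alpha < 1)
  (hp : forall (i : 'I_n) (w : Omega), 0 <= p i w <= 1)
  (hcover : (I0 :|: I1)%SET = [set: 'I_n]%SET)
  (hdisj : (I0 :&: I1)%SET = finset.set0)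
  (hI0 : (0 < #|I0|)%N)
  (hexp : forall t : R, 0 <= t < 1 ->
    ('E_P[nb_rejections I0 p t] <= (#|I0|%:R * t)%:E)%E)
  (hM : supermartingale P (times n (critical_value n alpha))
    (indicator_filtration (times n (critical_value n alpha)) p)
    (M_process I0 p)) :
  let tau := tau_SD (critical_value n alpha) p in
  let V := fun w : Omega => nb_rejections I0 p (tau w) w in
  let S := fun w : Omega => nb_rejections I1 p (tau w) w in
  ('E_P[V] <= (alpha / (1 - alpha))%:E * ('E_P[S] + 1) /\
   (alpha / (1 - alpha))%:E * ('E_P[S] + 1)
     <= (alpha / (1 - alpha) * (#|I1|%:R + 1))%:E)%E.
Proof.
move=> tau V S; have /andP[a0 a1] := halpha.
set beta := critical_value n alpha in hM tau V S *.
pose K := sd_index beta p.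
have mp i : measurable_fun setT (p i) by exact: measurable_funP.
have beta_homo i j : (i <= j <= n)%N -> beta i <= beta j.
  exact: critical_value_homo.
have beta0 : beta 0%N = 0 by exact: critical_value0.
have Dbeta j : (j <= n)%N -> times n beta (beta j).
  case: j => [|j] jn; first by left.
  by right; exists j.+1.
have tauE w : tau w = beta (K w) by exact: tau_SDE.
have iV : P.-integrable setT (EFin \o V).
  have := integrable_nb_rejections_sampled P I0 beta mp.
  by apply: eq_integrable => // w _; rewrite /= /V tauE.
have iS : P.-integrable setT (EFin \o S).
  have := integrable_nb_rejections_sampled P I1 beta mp.
  by apply: eq_integrable => // w _; rewrite /= /S tauE.
(* Optional stopping at the index [minn K.+1 n]. *)
have [|||iM leM] := optional_stopping (u := beta) (N := n)
  (J := fun w => minn (K w).+1 n) hM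
  (fun t _ => indicator_filtration_sub (t := t) mp) Dbeta.
- by move=> j jn; apply: beta_homo; rewrite leqnSn.
- by move=> w; exact: geq_minr.
- move=> j jn.
  rewrite (_ : [set w | _] = [set w | (j <= K w)%N]); last first.
    by apply/funext => w /=; rewrite leq_min jn andbT ltnS.
  apply: indicator_filtration_sd_index => //; last exact: ltnW.
  by move=> k /andP[_]; exact: Dbeta.
have LV : V \in Lfun P 1 by exact/Lfun1_integrable.
have LS : S \in Lfun P 1 by exact/Lfun1_integrable.
have LS1 : S \+ cst 1 \in Lfun P 1 by rewrite rpredD // Lfun_cst.
pose Z : Omega -> R := ((1 - alpha) \o* V) \- (alpha \o* (S \+ cst 1)).
have LZ : Z \in Lfun P 1 by rewrite rpredB // Lfun_scale.
have EZ : ('E_P[Z] = (1 - alpha)%:E * 'E_P[V] - alpha%:E * ('E_P[S] + 1))%E.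
  rewrite expectationB ?Lfun_scale // !expectationZl //.
  by rewrite expectationD ?Lfun_cst // expectation_cst.
have Z_le0 : ('E_P[Z] <= 0)%E.
  apply: (@le_trans _ _
    (\int[P]_w (M_process I0 p (beta (minn (K w).+1 n)) w)%:E)%E).
    rewrite unlock; apply: le_integral => //; first exact/Lfun1_integrable.
    move=> w _; rewrite lee_fin.
    have := M_process_stopped_ge p w halpha hcover hdisj.
    by rewrite /Z /V /S /= tauE [_ * (1 - alpha)]mulrC [_ * alpha]mulrC.
  (* At time 0 the process is the number of false rejections at threshold 0. *)
  apply: (le_trans leM); have := hexp 0; rewrite lexx ltr01 mulr0 => /(_ isT).
  apply: le_trans; rewrite unlock beta0.
  rewrite le_eqVlt; apply/orP; left; apply/eqP; apply: eq_integral => w _.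
  by rewrite M_processE mulr0 !subr0 divr1.
have EVfin := expectation_fin_num LV.
have ESfin := expectation_fin_num LS.
have S_le : ('E_P[S] <= #|I1|%:R%:E)%E.
  rewrite -(expectation_cst P); apply: expectation_le => //.
  - by case/integrableP: iS => /measurable_EFinP.
  - by move=> w; exact: nb_rejections_ge0.
  - by apply: aeW => w; exact: nb_rejections_le_card.
move: Z_le0 S_le; rewrite EZ -(fineK EVfin) -(fineK ESfin).
rewrite -EFinD -!EFinM !lee_fin => Z_le0 S_le; split.
  rewrite [leRHS]mulrAC ler_pdivlMr ?subr_gt0 //; lra.
by rewrite ler_wpM2l ?divr_ge0 ?subr_ge0 ?lerD2r // ltW.
Qed.
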